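(* Let $\Omega\subset\mathbb{R}^n$ be a domain and let $u\in C^2(\Omega)$ be a non-positive $H_1$-subharmonic function in $\Omega$. For a constant $t>0$ let $u_t=\max(u,-t)$. Then for any open set $\omega\Subset\Omega$, $$\int_\omega|Du_t|\le C,$$ where $C>0$ depends on $\omega$ and $t$ (and $\Omega$), but is independent of $u$.
   Context: $H_1[u]=\operatorname{div}\big(\frac{Du}{\sqrt{1+|Du|^2}}\big)$. A function $u:\Omega\to[-\infty,\infty)$ is $H_1$-subharmonic if it is upper semicontinuous, $\{u=-\infty\}$ has measure zero, and for every open $\omega\subset\Omega$ and $h\in C^2(\overline\omega)$ with $H_1[h]\le0$ in $\omega$ and $h\ge u$ on $\partial\omega$ one has $h\ge u$ in $\omega$. *)

(* Defs.v *)
From HB Require Import structures.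
From mathcomp Require Import all_boot all_order all_algebra.
From mathcomp Require Import all_classical all_reals all_analysis.
Set Implicit Arguments. Unset Strict Implicit. Unset Printing Implicit Defensive.
Import Order.TTheory GRing.Theory Num.Theory.
Import numFieldNormedType.Exports.
Local Open Scope classical_set_scope.
Local Open Scope ring_scope.

Section Defs.
Variables (R : realType) (n : nat).
Notation V := 'rV[R]_n.

Definition ebasis (i : 'I_n) : V := delta_mx 0 i.

Definition pd (i : 'I_n) (f : V -> R) : V -> R :=
  fun x => 'D_(ebasis i) f x.

Definition C1_on (A : set V) (f : V -> R) : Prop :=
  (forall x, A x -> {for x, continuous f}) /\
  forall i : 'I_n, (forall x, A x -> derivable f x (ebasis i)) /\
                   (forall x, A x -> {for x, continuous (pd i f)}).

Definition C2_on (A : set V) (f : V -> R) : Prop :=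
  C1_on A f /\ forall i : 'I_n, C1_on A (pd i f).

Definition ext_cont_closure (A : set V) (g : V -> R) : Prop :=
  exists G : V -> R, {within closure A, continuous G} /\
                     forall x, A x -> G x = g x.

Definition C2_closure (A : set V) (h : V -> R) : Prop :=
  C2_on A h /\ {within closure A, continuous h} /\
  (forall i : 'I_n, ext_cont_closure A (pd i h)) /\
  (forall i j : 'I_n, ext_cont_closure A (pd j (pd i h))).

Definition grad_sq (h : V -> R) (x : V) : R := \sum_(j < n) (pd j h x) ^+ 2.

Definition H1 (h : V -> R) (x : V) : R :=
  \sum_(i < n) pd i (fun y => pd i h y / Num.sqrt (1 + grad_sq h y)) x.

Definition usc_on (Omega : set V) (u : V -> R) : Prop :=
  forall x, Omega x -> forall a, u x < a ->
    \forall y \near x, Omega y -> u y < a.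

(* H_1-subharmonic (for real-valued u, so {u = -oo} is empty) *)
Definition H1_subharmonic (Omega : set V) (u : V -> R) : Prop :=
  usc_on Omega u /\
  forall (w : set V) (h : V -> R),
    open w -> closure w `<=` Omega ->
    C2_closure w h ->
    (forall x, w x -> H1 h x <= 0) ->
    (forall x, (closure w `\` w) x -> u x <= h x) ->
    forall x, w x -> u x <= h x.

(* Euclidean norm of the gradient of f at x where f is differentiable,
   0 elsewhere (the a.e. gradient of a locally Lipschitz function) *)
Definition grad_norm (f : V -> R) (x : V) : R :=
  if `[< differentiable f x >] then Num.sqrt (grad_sq f x) else 0.

End Defs.

(* Lebesgue integral of a nonnegative function on R^n, as the iterated
   integral (Tonelli) with respect to one-dimensional Lebesgue measure *)
Fixpoint iint (R : realType) (n : nat) : ('rV[R]_n -> \bar R) -> \bar R :=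
  match n with
  | 0 => fun f => f 0
  | m.+1 => fun f =>
      (\int[@lebesgue_measure R]_(x in setT)
         iint (fun y : 'rV[R]_m => f (row_mx (const_mx x : 'rV[R]_1) y)))%E
  end.

Definition domain (R : realType) (n : nat) (Omega : set 'rV[R]_n) : Prop :=
  open Omega /\ connected Omega /\ Omega !=set0.

Definition cpt_sub (R : realType) (n : nat) (w Omega : set 'rV[R]_n) : Prop :=
  compact (closure w) /\ closure w `<=` Omega.

(* Main.v *)
(* Put [W = sqrt (1 + |Du|^2)] and [E = exp (u / t)]. Comparison with [u] plus a small
   paraboloid shows that a C^2 subharmonic [u] satisfies [H1 u >= 0] pointwise. For a cutoff
   [phi], the field [phi E Du / W] has divergence
     phi E H1[u] + (phi E / t) |Du|^2 / W + E Dphi . Du / W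
   and integral of divergence zero; as [E <= 1] where [u <= 0] and [|Du| / W <= 1], the integral
   of [phi E |Du|^2 / W] is at most [t] times that of [sum_i |d_i phi|], whatever [u] is.
   On [{u > -t}] one has [E >= 1 / e] and [|Du| <= |Du|^2 / W + 1]; on [{u <= -t}] the truncation
   is minimal, so its gradient vanishes wherever it exists. The exponential plays the role of
   the usual test function [(u + t)^+] while keeping everything C^1. *)

Require Import Defs.
From HB Require Import structures.
From mathcomp Require Import all_boot all_order all_algebra.
From mathcomp Require Import all_classical all_reals all_analysis.
From mathcomp Require Import ring lra.
Set Implicit Arguments. Unset Strict Implicit. Unset Printing Implicit Defensive.
Import Order.TTheory GRing.Theory Num.Theory.
Import numFieldNormedType.Exports.
Local Open Scope classical_set_scope.
Local Open Scope ring_scope.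

(** * Iterated integrals of continuous functions over boxes *)

Section BoxIntegral.
Variable R : realType.
Implicit Types (M : R) (m n : nat).

(** Prepends a coordinate in exactly the form used by the recursion of [iint], so that both unfold
    alike. *)
Definition vcons m (x : R) (y : 'rV[R]_m) : 'rV[R]_m.+1 :=
  row_mx (const_mx x : 'rV[R]_1) y.

Lemma vcons0 m (x : R) (y : 'rV[R]_m) : vcons x y ord0 ord0 = x.
Proof.
have := row_mxEl (const_mx x : 'rV[R]_1) y ord0 ord0; rewrite [RHS]mxE.
by apply: etrans; congr (row_mx _ _ _ _); apply: ord_inj.
Qed.

Lemma vconsS m (x : R) (y : 'rV[R]_m) j : vcons x y ord0 (lift ord0 j) = y ord0 j.
Proof.
rewrite -(row_mxEr (const_mx x : 'rV[R]_1) y).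
by congr (row_mx _ _ _ _); apply: ord_inj.
Qed.

Lemma vcons_continuous m :
  continuous (fun p : R * 'rV[R]_m => vcons p.1 p.2).
Proof.
move=> [x y] A /nbhs_ballP[e /= e0 eA].
apply/nbhs_ballP; exists e => //= -[x' y'] [/= bx [_ bY]]; apply: eA; split=> // i j.
rewrite (ord1 i); case: (unliftP ord0 j) => [k ->|->].
  by rewrite !vconsS.
by rewrite !vcons0.
Qed.

Lemma vconsr_continuous m (x : R) : continuous (@vcons m x).
Proof.
move=> y; apply: (@continuous2_cvg _ _ _ _ (nbhs y) _ (cst x) id (@vcons m) x y).
- exact: (@vcons_continuous m (x, y)).
- exact: cvg_cst.
- exact: cvg_id.
Qed.

Lemma comp_vcons_continuous m (f : 'rV[R]_m.+1 -> R) x :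
  continuous f -> continuous (f \o vcons x).
Proof.
by move=> cf y; apply: continuous_comp; [exact: vconsr_continuous|exact: cf].
Qed.

Definition box M n : set 'rV[R]_n := [set v | forall i, `|v ord0 i| <= M].

Lemma box_compact M n : compact (@box M n).
Proof.
have := @rV_compact R n (fun=> `[- M, M]%classic) (fun=> @segment_compact _ _ _).
congr compact; apply/seteqP; split=> v /= vM i; have := vM i;
  by rewrite /= in_itv /= ler_norml.
Qed.

Lemma vcons_box M m x (y : 'rV[R]_m) :
  `|x| <= M -> box M y -> box M (vcons x y).
Proof.
move=> xM yM i; case: (unliftP ord0 i) => [k ->|->].
  by rewrite vconsS.
by rewrite vcons0.
Qed.

(** Compactness of the box turns joint continuity at each [(x, y)] into closeness uniform in [y]. *)
Lemma near_uniform_box M m (f : 'rV[R]_m.+1 -> R) x e : continuous f -> 0 < e ->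
  \forall x' \near x, forall y, box M y -> `|f (vcons x' y) - f (vcons x y)| < e.
Proof.
move=> cf e0.
have /compact_near_coveringP /(_ R (nbhs x)
  (fun x' y => `|f (vcons x' y) - f (vcons x y)| < e)) := @box_compact M m.
apply => y _.
have e20 : 0 < e / 2 by rewrite divr_gt0.
have cg : {for (y, x), continuous (fun p : 'rV[R]_m * R => f (vcons p.2 p.1))}.
  apply: (@continuous_comp _ _ _ (fun p : 'rV[R]_m * R => vcons p.2 p.1) f).
    apply: (@continuous2_cvg _ _ _ _ (nbhs (y, x)) _ snd fst (@vcons m) x y).
    - exact: (@vcons_continuous m (x, y)).
    - exact: cvg_snd.
    - exact: cvg_fst.
  exact: cf.
move/cvgr_dist_lt : cg => /(_ _ e20) [[/= A B] [yA xB]] AB.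
exists (A, B) => //= -[y' x'] [/= Ay' Bx'].
have := AB (y', x') (conj Ay' Bx').
have := AB (y', x) (conj Ay' (nbhs_singleton xB)) => /= h1 h2.
rewrite [e]splitr (le_lt_trans (ler_distD (f (vcons x y)) _ _))// addrC.
by rewrite ltrD// distrC.
Qed.

(** Real-valued counterpart of [iint] over the cube of half-side [M], iterated in the same order so
    that the two can be compared slice by slice. *)
Fixpoint boxint M n : ('rV[R]_n -> R) -> R :=
  match n with
  | 0 => fun f => f 0
  | m.+1 => fun f =>
      \int[lebesgue_measure]_(x in `[- M, M]) boxint M (fun y => f (vcons x y))
  end.

Lemma itv_continuous_integrable M (f : R -> R) : continuous f ->
  (@lebesgue_measure R).-integrable `[- M, M] (EFin \o f).
Proof.
move=> cf; apply: continuous_compact_integrable; first exact: segment_compact.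
exact: continuous_subspaceT.
Qed.

Lemma eq_boxint M n (f g : 'rV[R]_n -> R) : f =1 g -> boxint M f = boxint M g.
Proof. by move=> /funext ->. Qed.

Section step.
Variables (M : R) (m : nat).
Hypothesis M0 : 0 <= M.
Hypothesis lin : forall a (f g : 'rV[R]_m -> R), continuous f -> continuous g ->
  boxint M (fun x => a * f x + g x) = a * boxint M f + boxint M g.
Hypothesis le_int : forall f g : 'rV[R]_m -> R, continuous f -> continuous g ->
  (forall x, box M x -> f x <= g x) -> boxint M f <= boxint M g.
Hypothesis cst_int : forall c : R, boxint M (fun _ : 'rV[R]_m => c) = c * (M *+ 2) ^+ m.

Lemma ler_dist_boxint (f g : 'rV[R]_m -> R) (e : R) : continuous f -> continuous g ->
  (forall x, box M x -> `|f x - g x| <= e) ->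
  `|boxint M f - boxint M g| <= e * (M *+ 2) ^+ m.
Proof.
move=> cf cg fge.
have cfe (h : 'rV[R]_m -> R) (d : R) : continuous h -> continuous (fun x : 'rV[R]_m => h x + d).
  by move=> ch x; exact: (cvgD (ch x) (cvg_cst d)).
have D (h : 'rV[R]_m -> R) (d : R) : continuous h ->
    boxint M (fun x => h x + d) = boxint M h + d * (M *+ 2) ^+ m.
  have cd : continuous (fun _ : 'rV[R]_m => d) by exact: cst_continuous.
  move=> ch; have := lin 1 ch cd.
  rewrite cst_int mul1r => <-.
  by apply: eq_boxint => x; rewrite mul1r.
have le1 : boxint M g <= boxint M f + e * (M *+ 2) ^+ m.
  rewrite -D//; apply: le_int => //; first exact: cfe.
  by move=> x /fge; rewrite ler_norml => /andP[]; lra.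
have le2 : boxint M f <= boxint M g + e * (M *+ 2) ^+ m.
  rewrite -D//; apply: le_int => //; first exact: cfe.
  by move=> x /fge; rewrite ler_norml => /andP[]; lra.
by rewrite ler_norml; apply/andP; split; lra.
Qed.

Lemma boxint_vcons_continuous (f : 'rV[R]_m.+1 -> R) :
  continuous f -> continuous (fun x => boxint M (fun y => f (vcons x y))).
Proof.
move=> cf x; apply/cvgrPdist_le => e e0.
(* The added 1 keeps the denominator positive even when [M = 0]. *)
pose d := e / ((M *+ 2) ^+ m + 1).
have D0 : 0 < (M *+ 2) ^+ m + 1 :> R.
  by rewrite ltr_wpDl// exprn_ge0// mulrn_wge0.
have d0 : 0 < d by rewrite divr_gt0.
near=> x'.
rewrite distrC (le_trans (@ler_dist_boxint _ _ d _ _ _))//.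
- exact: comp_vcons_continuous.
- exact: comp_vcons_continuous.
- move=> y yM; apply: ltW; move: y yM; near: x'.
  exact: near_uniform_box.
- by rewrite /d mulrAC ler_pdivrMr// ler_wpM2l ?ltW// ltrDl.
Unshelve. all: by end_near. Qed.

End step.

(** The three properties go through a single induction: together, in dimension [m], they make the
    inner integral continuous in the outer variable, and this continuity gives the integrability
    that dimension [m.+1] requires. *)
Lemma boxint_props M m : 0 <= M ->
  [/\ forall (a : R) (f g : 'rV[R]_m -> R), continuous f -> continuous g ->
        boxint M (fun x => a * f x + g x) = a * boxint M f + boxint M g,
      forall f g : 'rV[R]_m -> R, continuous f -> continuous g ->
        (forall x, box M x -> f x <= g x) -> boxint M f <= boxint M g &
      forall c : R, boxint M (fun _ : 'rV[R]_m => c) = c * (M *+ 2) ^+ m].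
Proof.
move=> M0; elim: m => [|m [lin le_int cst_int]].
  split=> //=; last by move=> c; rewrite expr0 mulr1.
  by move=> f g _ _; apply => -[].
have cI := @boxint_vcons_continuous M m M0 lin le_int cst_int.
split=> [a f g cf cg|f g cf cg fg|c] /=.
- rewrite -RintegralZl//; last exact/itv_continuous_integrable/cI.
  rewrite -RintegralD//; last 2 first.
  + apply: (@itv_continuous_integrable _ (fun x => a * boxint M (fun y => f (vcons x y)))).
    by move=> x; exact: (cvgM (cvg_cst a) (cI f cf x)).
  + exact/itv_continuous_integrable/cI.
  by apply: eq_Rintegral => x _; rewrite lin//; exact: comp_vcons_continuous.
- apply: le_Rintegral => //.
  + exact/itv_continuous_integrable/cI.
  + exact/itv_continuous_integrable/cI.
  move=> x; rewrite /= in_itv/= -ler_norml => xM.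
  apply: le_int; [exact: comp_vcons_continuous|exact: comp_vcons_continuous|].
  by move=> y yM; apply: fg; exact: vcons_box.
- under eq_Rintegral do rewrite cst_int.
  rewrite Rintegral_cst//.
  rewrite exprSr mulrA; congr (_ * _).
  suff mE : lebesgue_measure `[- M, M]%classic = (M *+ 2)%:E by exact: (congr1 fine mE).
  rewrite lebesgue_measure_itv/= lte_fin; case: ltP => [_|M1].
    by rewrite -EFinD /= opprK mulr2n.
  by have -> : M = 0 by [lra]; rewrite mul0rn.
Qed.

End BoxIntegral.

(** * Differentiation under the integral sign and integration of a derivative *)

Section BoxIntegralDerivative.
Variable R : realType.
Implicit Types (M : R) (m n : nat).

Lemma boxint_lin M n (a : R) (f g : 'rV[R]_n -> R) : 0 <= M ->
  continuous f -> continuous g ->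
  boxint M (fun x => a * f x + g x) = a * boxint M f + boxint M g.
Proof. by move=> M0; case: (@boxint_props R M n M0) => + _ _; exact. Qed.

Lemma boxint0 M n : 0 <= M -> boxint M (fun _ : 'rV[R]_n => 0) = 0.
Proof. by move=> M0; case: (@boxint_props R M n M0) => _ _ ->; rewrite mul0r. Qed.

Lemma boxintD M n (f g : 'rV[R]_n -> R) : 0 <= M -> continuous f -> continuous g ->
  boxint M (fun x => f x + g x) = boxint M f + boxint M g.
Proof.
move=> M0 cf cg; rewrite -[in RHS](mul1r (boxint M f)) -boxint_lin//.
by apply: eq_boxint => x; rewrite mul1r.
Qed.

Lemma boxintZ M n (a : R) (f : 'rV[R]_n -> R) : 0 <= M -> continuous f ->
  boxint M (fun x => a * f x) = a * boxint M f.
Proof.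
move=> M0 cf; have c0 : continuous (fun _ : 'rV[R]_n => 0 : R) by exact: cst_continuous.
rewrite -[RHS]addr0 -(@boxint0 M n M0) -boxint_lin//.
by apply: eq_boxint => x; rewrite addr0.
Qed.

Lemma boxint_sum M n (I : Type) (s : seq I) (F : I -> 'rV[R]_n -> R) : 0 <= M ->
  (forall i, continuous (F i)) ->
  continuous (fun x => \sum_(i <- s) F i x) /\
  boxint M (fun x => \sum_(i <- s) F i x) = \sum_(i <- s) boxint M (F i).
Proof.
move=> M0 cF; elim: s => [|i s [cs IH]].
  rewrite big_nil (@eq_boxint _ _ _ _ (fun=> 0)) ?boxint0//; last first.
    by move=> x; rewrite big_nil.
  by split=> // x; under eq_fun do rewrite big_nil; exact: cst_continuous.
have E : (fun x => \sum_(j <- i :: s) F j x) = (fun x => F i x + \sum_(j <- s) F j x).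
  by apply/funext => x; rewrite big_cons.
rewrite E; split; first by move=> x; exact: (cvgD (cF i x) (cs x)).
by rewrite boxintD// big_cons IH.
Qed.

Lemma le_boxint_dist M n (f g : 'rV[R]_n -> R) (e : R) : 0 <= M ->
  continuous f -> continuous g ->
  (forall x, box M x -> `|f x - g x| <= e) ->
  `|boxint M f - boxint M g| <= e * (M *+ 2) ^+ n.
Proof.
by move=> M0; case: (@boxint_props R M n M0) => l le c; exact: ler_dist_boxint.
Qed.

Lemma continuous_boxint_vcons M m (f : 'rV[R]_m.+1 -> R) : 0 <= M ->
  continuous f -> continuous (fun x => boxint M (fun y => f (vcons x y))).
Proof.
move=> M0; case: (@boxint_props R M m M0) => l le c.
exact: boxint_vcons_continuous.
Qed.

Lemma vcons_shift0 m (h x : R) (y : 'rV[R]_m) :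
  vcons (h + x) y = h *: ebasis R ord0 + vcons x y.
Proof.
apply/rowP => i; rewrite [RHS]mxE [X in _ = X + _]mxE [X in _ = _ * X + _]mxE /=.
case: (unliftP ord0 i) => [k ->|->].
  by rewrite !vconsS mulr0 add0r.
by rewrite !vcons0 mulr1.
Qed.

Lemma vcons_shiftS m (h x : R) (y : 'rV[R]_m) j :
  vcons x (h *: ebasis R j + y) = h *: ebasis R (lift ord0 j) + vcons x y.
Proof.
apply/rowP => i; rewrite [RHS]mxE [X in _ = X + _]mxE [X in _ = _ * X + _]mxE /=.
case: (unliftP ord0 i) => [k ->|->].
  by rewrite !vconsS !mxE /= (inj_eq (@lift_inj _ _)).
by rewrite !vcons0 mulr0 add0r.
Qed.

(** Equating the difference quotients as functions transfers derivability and the value of the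
    derivative at once. *)
Lemma diffq_vconsS m (g : 'rV[R]_m.+1 -> R) (x : R) y j :
  (fun h : R => h^-1 *: (((g \o vcons x) \o shift y) (h *: ebasis R j) - (g \o vcons x) y)) =
  (fun h => h^-1 *: ((g \o shift (vcons x y)) (h *: ebasis R (lift ord0 j)) - g (vcons x y))).
Proof. by apply/funext => h /=; rewrite vcons_shiftS. Qed.

Lemma diffq_vcons0 m (g : 'rV[R]_m.+1 -> R) (x : R) y :
  (fun h : R => h^-1 *: (((fun z : R => g (vcons z y)) \o shift x) (h *: 1) - g (vcons x y))) =
  (fun h => h^-1 *: ((g \o shift (vcons x y)) (h *: ebasis R ord0) - g (vcons x y))).
Proof. by apply/funext => h /=; rewrite vcons_shift0 [h *: 1]mulr1. Qed.

Lemma pd_vconsS m (g : 'rV[R]_m.+1 -> R) (x : R) y j :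
  pd j (g \o vcons x) y = pd (lift ord0 j) g (vcons x y).
Proof. by rewrite /pd /derive diffq_vconsS. Qed.

Lemma derivable_vconsS m (g : 'rV[R]_m.+1 -> R) (x : R) y j :
  derivable (g \o vcons x) y (ebasis R j) <->
  derivable g (vcons x y) (ebasis R (lift ord0 j)).
Proof. by rewrite /derivable diffq_vconsS. Qed.

Lemma is_derive_vcons0 m (g : 'rV[R]_m.+1 -> R) (x : R) y :
  derivable g (vcons x y) (ebasis R ord0) ->
  is_derive x 1 (fun z : R => g (vcons z y)) (pd ord0 g (vcons x y)).
Proof.
move=> dg; split; first by rewrite /derivable diffq_vcons0.
by rewrite /pd /derive diffq_vcons0.
Qed.

(** The increment [h] may have either sign, as it does in the punctured limit that defines a
    derivative. *)
Lemma mean_value (f df : R -> R) (x h : R) : (forall z : R, is_derive z 1 f (df z)) ->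
  exists2 c, `|c - x| <= `|h| & f (h + x) - f x = h * df c.
Proof.
move=> dfE; have cf : continuous f.
  move=> z; apply: differentiable_continuous; apply/derivable1_diffP.
  by have [] := dfE z.
have [h0|h0] := leP 0 h.
  have [|c] := @MVT_segment _ f df x (h + x) _ (fun z _ => dfE z)
    (continuous_subspaceT cf); first by rewrite lerDr.
  rewrite in_itv/= => /andP[xc ch] ->; exists c; last by ring.
  by rewrite !ger0_norm ?subr_ge0 ?lerBlDr.
have [|c] := @MVT_segment _ f df (h + x) x _ (fun z _ => dfE z)
    (continuous_subspaceT cf); first by rewrite gerDr ltW.
rewrite in_itv/= => /andP[xc ch] E; exists c.
  by rewrite ler0_norm ?subr_le0// ltr0_norm// lerN2 lerBrDr.
by rewrite -opprB E; ring.
Qed.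

(** By the mean value theorem each difference quotient is a value of [pd ord0 g] at a nearby first
    coordinate, which is uniformly close to its value at [x] over the box of remaining variables. *)
Lemma is_derive_boxint M m (g : 'rV[R]_m.+1 -> R) (x : R) : 0 <= M ->
  continuous g -> (forall z, derivable g z (ebasis R ord0)) -> continuous (pd ord0 g) ->
  is_derive x 1 (fun z : R => boxint M (fun y => g (vcons z y)))
    (boxint M (fun y => pd ord0 g (vcons x y))).
Proof.
move=> M0 cg dg cdg; set phi := fun z : R => _.
have H : (fun h : R => h^-1 *: ((phi \o shift x) (h *: 1) - phi x)) @ 0^' -->
    boxint M (fun y => pd ord0 g (vcons x y)).
  apply/cvgrPdist_le => e e0.
  pose K : R := (M *+ 2) ^+ m.
  have K0 : 0 <= K by rewrite exprn_ge0// mulrn_wge0.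
  pose d := e / (K + 1).
  have d0 : 0 < d by rewrite divr_gt0// ltr_wpDl.
  have /nbhs_ballP[r /= r0 rP] := near_uniform_box M x cdg d0.
  near=> h.
  have h0 : h != 0 by near: h; exact: nbhs_dnbhs_neq.
  have hr : `|h| < r.
    near: h; apply: nbhs_dnbhs; apply/nbhs_ballP; exists r => // z.
    by rewrite /ball/= sub0r normrN.
  have c1 z : continuous (fun y => g (vcons z y)) by exact: comp_vcons_continuous.
  have -> : h^-1 *: ((phi \o shift x) (h *: 1) - phi x) =
      boxint M (fun y => h^-1 * (g (vcons (h + x) y) - g (vcons x y))).
    rewrite boxintZ//; last by move=> y; exact: (cvgB (c1 (h + x) y) (c1 x y)).
    rewrite /= [h *: 1]mulr1; congr (_ * _).
    rewrite (_ : (fun y => _) = (fun y => (-1) * g (vcons x y) + g (vcons (h + x) y))).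
      by rewrite boxint_lin// mulN1r addrC.
    by apply/funext => y; rewrite mulN1r addrC.
  apply: le_trans (@le_boxint_dist _ _ _ _ d M0 _ _ _) _.
  - exact: comp_vcons_continuous.
  - by move=> y; exact: (cvgM (cvg_cst _) (cvgB (c1 (h + x) y) (c1 x y))).
  - move=> y yM.
    have [c cx ->] := mean_value x h (fun z => @is_derive_vcons0 m g z y (dg _)).
    rewrite mulKf// distrC ltW//; apply: rP => //=.
    by rewrite /ball/= distrC (le_lt_trans cx).
  - by rewrite -/K /d mulrAC ler_pdivrMr ?ltr_wpDl// ler_wpM2l ?ltW// ltrDl.
split; first by apply/cvg_ex; exists (boxint M (fun y => pd ord0 g (vcons x y))).
exact: cvg_lim H.
Unshelve. all: by end_near. Qed.

(** The divergence theorem for a compactly supported field, one component at a time. For a later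
    coordinate the inner integral vanishes by induction on the dimension. For the first one, the
    fundamental theorem of calculus applies to the inner integral of [g], which is zero at both
    ends. *)
Lemma boxint_pd M n (g : 'rV[R]_n -> R) (i : 'I_n) : 0 < M -> C1_on setT g ->
  (forall x : 'rV[R]_n, (exists k, M <= `|x ord0 k|) -> g x = 0) ->
  boxint M (pd i g) = 0.
Proof.
move=> M0; have M0' := ltW M0.
elim: n g i => [|m IH] g i; first by case: i.
move=> [cg dg] g0.
have {}cg : continuous g by move=> x; exact: cg.
have dgi k x : derivable g x (ebasis R k) by have [+ _] := dg k; exact.
have cgi k : continuous (pd k g) by move=> x; have [_ +] := dg k; exact.
case: (unliftP ord0 i) => [j ->|->] /=.
  rewrite (_ : (fun x => _) = (fun=> 0)).
    by rewrite Rintegral_cst// mul0r.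
  apply/funext => x; rewrite -[RHS](IH (g \o vcons x) j).
  - by apply: eq_boxint => y; rewrite pd_vconsS.
  - split; first by move=> y _; exact: comp_vcons_continuous.
    move=> k; split; first by move=> y _; apply/derivable_vconsS.
    move=> y _; rewrite (_ : pd k _ = pd (lift ord0 k) g \o vcons x).
      exact: comp_vcons_continuous.
    by apply/funext => z; rewrite pd_vconsS.
  - move=> y [k yk]; apply: g0; exists (lift ord0 k).
    by rewrite vconsS.
pose phi (x : R) := boxint M (fun y => g (vcons x y)).
have dphi (x : R) := is_derive_boxint x M0' cg (dgi ord0) (cgi ord0).
have cphi : continuous phi.
  move=> z; apply: differentiable_continuous; apply/derivable1_diffP.
  by have [] := dphi z.
have NM : - M < M by rewrite gtrN.
have phi0 (x : R) : M <= `|x| -> phi x = 0.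
  move=> Mx; rewrite /phi (_ : (fun y => _) = fun=> 0) ?boxint0//.
  by apply/funext => y; apply: g0; exists ord0; rewrite vcons0.
rewrite /Rintegral (@continuous_FTC2 _ _ phi _ _ NM).
- by rewrite !phi0 ?normrN ?ger0_norm//= subr0.
- apply: continuous_subspaceT.
  exact: continuous_boxint_vcons.
- split.
  + by move=> x _; have [] := dphi x.
  + exact/cvg_at_right_filter/cphi.
  + exact/cvg_at_left_filter/cphi.
- by move=> x _; rewrite derive1E; have [] := dphi x.
Qed.

End BoxIntegralDerivative.

(** * Comparison of the iterated integral over the whole space with the box integral *)

Section IteratedIntegral.
Variable R : realType.
Implicit Types (M : R) (m n : nat).

Lemma iint_ge0 n (f : 'rV[R]_n -> \bar R) : (forall x, 0 <= f x)%E -> (0 <= iint f)%E.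
Proof.
elim: n f => [|m IH] f f0 /=; first exact: f0.
by apply: integral_ge0 => x _; apply: IH => y; exact: f0.
Qed.

(** The integral of a non-negative function is a supremum over the simple functions below it, hence
    monotone for arbitrary functions. The truncated gradient can thus be compared with a continuous
    majorant without a study of its measurability. *)
Lemma le_iint n (f g : 'rV[R]_n -> \bar R) : (forall x, 0 <= f x)%E ->
  (forall x, f x <= g x)%E -> (iint f <= iint g)%E.
Proof.
elim: n f g => [|m IH] f g f0 fg /=; first exact: fg.
have g0 x : (0 <= g x)%E by exact: le_trans (fg x).
rewrite !ge0_integralTE; last 2 first.
- by move=> x; apply: iint_ge0 => y; exact: g0.
- by move=> x; apply: iint_ge0 => y; exact: f0.
apply: le_ereal_sup => _ [h hf <-]; exists h => // x.
by apply: le_trans (hf x) _; apply: IH => y; [exact: f0|exact: fg].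
Qed.

Lemma iint_boxint M n (f : 'rV[R]_n -> R) : 0 <= M -> continuous f ->
  (forall x : 'rV[R]_n, (exists k, M < `|x ord0 k|) -> f x = 0) ->
  iint (fun x => (f x)%:E) = (boxint M f)%:E.
Proof.
move=> M0; elim: n f => [//|m IH] f cf f0 /=.
have cphi := continuous_boxint_vcons M0 cf.
set phi := (fun x => boxint M _) in cphi.
rewrite /Rintegral fineK; last first.
  apply: integrable_fin_num => //; exact: itv_continuous_integrable.
rewrite [RHS]integral_mkcond; apply: eq_integral => x _; rewrite /patch.
rewrite (IH (f \o vcons x)); last 2 first.
- exact: comp_vcons_continuous.
- by move=> y [k yk]; apply: f0; exists (lift ord0 k); rewrite vconsS.
case: ifPn => // /negP xM; rewrite (@eq_boxint _ _ _ _ (fun=> 0)) ?boxint0// => y.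
apply: f0; exists ord0; rewrite vcons0 ltNge; apply/negP => xM'; apply: xM.
by rewrite inE /= in_itv /= -ler_norml.
Qed.

End IteratedIntegral.

(** * Calculus of directional derivatives *)

Section DirectionalCalculus.
Variables (R : realType) (n : nat).
Notation V := 'rV[R]_n.
Implicit Types (f g : V -> R) (A : set V) (x v : V).

Lemma sum_cvg (T : Type) (F : set_system T) (FF : Filter F) (I : Type) (s : seq I)
    (f : I -> T -> R) (a : I -> R) : (forall i, f i @ F --> a i) ->
  (fun t => \sum_(i <- s) f i t) @ F --> \sum_(i <- s) a i.
Proof.
move=> fa; elim: s => [|i s IH].
  by rewrite big_nil; under eq_fun do rewrite big_nil; exact: cvg_cst.
by rewrite big_cons; under eq_fun do rewrite big_cons; exact: (cvgD (fa i) IH).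
Qed.

Lemma is_derive_lineP f x v df :
  is_derive x v f df <-> is_derive (0 : R) (1 : R) (fun h : R => f (h *: v + x)) df.
Proof.
have E : (fun h : R => h^-1 *: (((fun h : R => f (h *: v + x)) \o shift 0) (h *: 1) -
    f (0 *: v + x))) = (fun h => h^-1 *: ((f \o shift x) (h *: v) - f x)).
  by apply/funext => h /=; rewrite addr0 scale0r add0r [h *: 1]mulr1.
by split=> -[d e]; split; move: d e; rewrite /derivable /derive E.
Qed.

(** Only a derivative along [v] is given, so the one-variable chain rule is applied on the line
    through [x]. *)
Lemma is_derive_comp (F : R -> R) (F' : R) f x v df :
  is_derive (f x) 1 F F' -> is_derive x v f df ->
  is_derive x v (F \o f) (F' * df).
Proof.
move=> dF /is_derive_lineP dfx; apply/is_derive_lineP.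
apply: (@is_derive1_comp _ F (fun h : R => f (h *: v + x))) => //.
by rewrite scale0r add0r.
Qed.

Lemma is_derive_coord i j x :
  is_derive x (ebasis R j) (fun y : V => y ord0 i) (i == j)%:R.
Proof.
apply/is_derive_lineP.
rewrite (_ : (fun h => _) = (fun h : R => (i == j)%:R * h + x ord0 i)).
  have := @is_deriveD _ _ _ _ _ (0 : R) 1 _ _
    (@is_deriveZ _ _ _ id (i == j)%:R (0 : R) 1 1 (is_derive_id _ _))
    (is_derive_cst (x ord0 i) _ _).
  by rewrite addr0 [_ *: 1]mulr1.
by apply/funext => h; rewrite !mxE /= mulrC.
Qed.

Lemma near_eq_continuous (T U : topologicalType) (f g : T -> U) (x : T) :
  (\near x, f x = g x) -> {for x, continuous f} -> {for x, continuous g}.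
Proof.
move=> fg; rewrite /prop_for /continuous_at -(nbhs_singleton fg) => cf.
by apply: cvg_trans cf; exact: near_eq_cvg.
Qed.

(** Being C^1 with an explicit gradient: the rules below produce regularity and the formula for the
    derivatives together. *)
Definition has_grad A f (df : 'I_n -> V -> R) := forall x, A x ->
  {for x, continuous f} /\
  forall i, is_derive x (ebasis R i) f (df i x) /\ {for x, continuous (df i)}.

Lemma C1_has_grad A f : C1_on A f -> has_grad A f (fun i => pd i f).
Proof.
move=> [cf df] x Ax; split; first exact: cf.
move=> i; have [dfi cfi] := df i; split; last exact: cfi.
by apply: DeriveDef => //; exact: dfi.
Qed.

Lemma has_grad_near A f g df : open A -> has_grad A f df ->
  (forall x, A x -> f x = g x) -> has_grad A g df.
Proof.
move=> oA fdf fg x Ax; have [cf df'] := fdf x Ax.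
have nfg : \near x, f x = g x.
  have : nbhs x A by exact: open_nbhs_nbhs.
  by apply: filterS => y; exact: fg.
split.
  exact: near_eq_continuous cf.
move=> i; have [dfi cfi] := df' i; split=> //.
exact: near_eq_is_derive nfg dfi.
Qed.

Lemma has_grad_pd A f df i x : has_grad A f df -> A x -> pd i f x = df i x.
Proof. by move=> fdf Ax; have [_ /(_ i)[[_ +] _]] := fdf x Ax. Qed.

Lemma has_grad_C1 A f df : open A -> has_grad A f df -> C1_on A f.
Proof.
move=> oA fdf; split; first by move=> x Ax; have [] := fdf x Ax.
move=> i; split; first by move=> x Ax; have [_ /(_ i)[[]]] := fdf x Ax.
move=> x Ax; have [_ /(_ i)[_ c]] := fdf x Ax.
apply: near_eq_continuous c.
have : nbhs x A by exact: open_nbhs_nbhs.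
by apply: filterS => y Ay; rewrite (has_grad_pd i fdf Ay).
Qed.

Lemma has_grad_eq A f df dg : has_grad A f df ->
  (forall i x, df i x = dg i x) -> has_grad A f dg.
Proof. by move=> + E; have -> : df = dg by apply/funext => i; apply/funext => x. Qed.

Lemma has_grad_sub A B f df : A `<=` B -> has_grad B f df -> has_grad A f df.
Proof. by move=> AB fdf x /AB; exact: fdf. Qed.

Lemma has_grad_cst A (c : R) : has_grad A (fun=> c) (fun _ _ => 0).
Proof.
move=> x _; split; first exact: cst_continuous.
by move=> i; split; [exact: is_derive_cst|exact: cst_continuous].
Qed.

Lemma has_gradD A f g df dg : has_grad A f df -> has_grad A g dg ->
  has_grad A (fun x => f x + g x) (fun i x => df i x + dg i x).
Proof.
move=> fdf gdg x Ax; have [cf df'] := fdf x Ax; have [cg dg'] := gdg x Ax.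
split; first exact: (cvgD cf cg).
move=> i; have [d1 c1] := df' i; have [d2 c2] := dg' i.
by split; [exact: is_deriveD|exact: (cvgD c1 c2)].
Qed.

Lemma has_gradM A f g df dg : has_grad A f df -> has_grad A g dg ->
  has_grad A (fun x => f x * g x) (fun i x => f x * dg i x + g x * df i x).
Proof.
move=> fdf gdg x Ax; have [cf df'] := fdf x Ax; have [cg dg'] := gdg x Ax.
split; first exact: (cvgM cf cg).
move=> i; have [d1 c1] := df' i; have [d2 c2] := dg' i.
split; first exact: is_deriveM.
exact: (cvgD (cvgM cf c2) (cvgM cg c1)).
Qed.

Lemma has_grad_sum A (I : Type) (s : seq I) (F : I -> V -> R) dF :
  (forall k, has_grad A (F k) (dF k)) ->
  has_grad A (fun x => \sum_(k <- s) F k x) (fun i x => \sum_(k <- s) dF k i x).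
Proof.
move=> FdF; elim: s => [|k s IH].
  have -> : (fun x => \sum_(k <- [::]) F k x) = fun=> 0 by apply/funext => x; rewrite big_nil.
  apply: (@has_grad_eq A _ (fun _ _ => 0)); first exact: has_grad_cst.
  by move=> i x; rewrite big_nil.
have -> : (fun x => \sum_(j <- k :: s) F j x) = (fun x => F k x + \sum_(j <- s) F j x).
  by apply/funext => x; rewrite big_cons.
by apply: has_grad_eq (has_gradD (FdF k) IH) _ => i x; rewrite big_cons.
Qed.

Lemma has_grad_comp A (F F' : R -> R) f df : has_grad A f df ->
  (forall x, A x -> is_derive (f x) 1 F (F' (f x)) /\ {for f x, continuous F'}) ->
  has_grad A (fun x => F (f x)) (fun i x => F' (f x) * df i x).
Proof.
move=> fdf FF' x Ax; have [cf df'] := fdf x Ax; have [dF cF'] := FF' x Ax.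
split.
  apply: (@continuous_comp _ _ _ f F) => //.
  by apply: differentiable_continuous; apply/derivable1_diffP; case: dF.
move=> i; have [dfi cfi] := df' i; split; first exact: is_derive_comp.
exact: (cvgM (continuous_comp cf cF') cfi).
Qed.

Lemma has_grad_coord A j (c : R) :
  has_grad A (fun x => x ord0 j - c) (fun i _ => (j == i)%:R).
Proof.
move=> x _; split.
  exact: (cvgB (@coord_continuous _ _ _ _ _ x) (cvg_cst c)).
move=> i; split; last exact: cst_continuous.
have := is_deriveB (is_derive_coord j i x) (is_derive_cst c x (ebasis R i)).
by rewrite subr0.
Qed.

Definition sqdist (c y : V) : R := \sum_(j < n) (y ord0 j - c ord0 j) ^+ 2.

Lemma has_grad_sqdist A c :
  has_grad A (sqdist c) (fun i y => 2 * (y ord0 i - c ord0 i)).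
Proof.
have H j := has_gradM (has_grad_coord (A := A) j (c ord0 j)) (has_grad_coord j (c ord0 j)).
apply: has_grad_eq (has_grad_sum (index_enum 'I_n) H) _ => i y.
rewrite (bigD1 i)//= big1 ?addr0 => [|k ki]; first by rewrite eqxx !mulr1; ring.
by rewrite (negbTE ki) mulr0 addr0.
Qed.

Lemma sqdist_ge (c y : V) j : (y ord0 j - c ord0 j) ^+ 2 <= sqdist c y.
Proof.
by rewrite /sqdist (bigD1 j)//= lerDl sumr_ge0// => i _; exact: sqr_ge0.
Qed.

Lemma sqdistxx (c : V) : sqdist c c = 0.
Proof. by rewrite /sqdist big1// => i _; rewrite subrr expr0n. Qed.

Lemma sqdist_continuous c : continuous (sqdist c).
Proof. by move=> x; have [] := @has_grad_sqdist setT c x I. Qed.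

(** The topology is that of the sup norm; a Euclidean ball of radius [e / 2] lies in the sup-norm
    ball of radius [e], because each coordinate difference is at most the Euclidean distance. *)
Lemma nbhs_sqdist x A : nbhs x A -> exists2 s, 0 < s & forall y, sqdist x y <= s -> A y.
Proof.
move=> /nbhs_ballP[e /= e0 eA]; exists ((e / 2) ^+ 2); first by rewrite exprn_gt0 ?divr_gt0.
move=> y yx; apply: eA; split=> // i j; rewrite ord1.
rewrite /ball/= (@le_lt_trans _ _ (e / 2))//; last by lra.
have e20 : 0 <= e / 2 by rewrite divr_ge0 ?ltW.
have := le_trans (sqdist_ge x y j) yx.
by rewrite distrC -(@ler_pXn2r _ 2)// ?nnegrE// real_normK ?num_real.
Qed.

End DirectionalCalculus.

(** * Pointwise subharmonicity *)

Section Subharmonic.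
Variables (R : realType) (n : nat).
Notation V := 'rV[R]_n.
Implicit Types (u h : V -> R) (A : set V).

Lemma is_derive_invsqrt (s : R) : 0 < s ->
  is_derive s (1 : R) (fun s => (Num.sqrt s)^-1)
    (- (Num.sqrt s) ^- 2 * (2 * Num.sqrt s)^-1).
Proof.
move=> s0; apply: (@is_deriveV _ Num.sqrt s); last exact: is_derive1_sqrt.
by rewrite gt_eqF// sqrtr_gt0.
Qed.

Lemma invsqrt_cvg (s : R) : 0 < s ->
  {for s, continuous (fun s : R => (Num.sqrt s)^-1)}.
Proof.
move=> s0; apply: cvgV; last exact: sqrt_continuous.
by rewrite gt_eqF// sqrtr_gt0.
Qed.

Lemma invsqrt'_cvg (s : R) : 0 < s ->
  {for s, continuous (fun s : R => - (Num.sqrt s) ^- 2 * (2 * Num.sqrt s)^-1)}.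
Proof.
move=> s0; have q0 : 0 < Num.sqrt s by rewrite sqrtr_gt0.
have q : {for s, continuous (@Num.sqrt R)} by exact: sqrt_continuous.
apply: (@cvgM _ _ _ _ (fun s => - (Num.sqrt s) ^- 2) (fun s => (2 * Num.sqrt s)^-1)).
  apply: (@cvgN _ _ _ _ _ (fun s => (Num.sqrt s) ^- 2)).
  apply: (@cvgV _ _ _ _ (fun s => (Num.sqrt s) ^+ 2)); first by rewrite gt_eqF// exprn_gt0.
  exact: (cvgM q q).
apply: (@cvgV _ _ _ _ (fun s => 2 * Num.sqrt s)); first by rewrite gt_eqF// mulr_gt0.
exact: (cvgM (cvg_cst _) q).
Qed.

(* The derivative in direction [j] of the [i]-th component of [Du / sqrt (1 + |Du|^2)],
   in terms of the gradient [p] and the Hessian [H] of [u]. *)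
Definition flux_deriv (p : 'I_n -> R) (H : 'I_n -> 'I_n -> R) (i j : 'I_n) : R :=
  let s := 1 + \sum_k p k ^+ 2 in
  p i * ((- (Num.sqrt s) ^- 2 * (2 * Num.sqrt s)^-1) * (0 + \sum_k (p k * H k j + p k * H k j)))
  + (Num.sqrt s)^-1 * H i j.

Lemma one_grad_gt0 (p : 'I_n -> R) : 0 < 1 + \sum_k p k ^+ 2.
Proof. by rewrite ltr_pwDl// sumr_ge0// => i _; exact: sqr_ge0. Qed.

(** The general filter allows the base point and the coefficient of the paraboloid to vary
    jointly. *)
Lemma flux_deriv_cvg (T : Type) (F : set_system T) (FF : Filter F)
    (p : 'I_n -> T -> R) (H : 'I_n -> 'I_n -> T -> R) p0 H0 i j :
  (forall k, p k @ F --> (p0 k : R)) -> (forall k l, H k l @ F --> (H0 k l : R)) ->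
  (fun t => flux_deriv (fun k => p k t) (fun k l => H k l t) i j) @ F -->
    flux_deriv p0 H0 i j.
Proof.
move=> cp cH.
have cs : (fun t => 1 + \sum_k p k t ^+ 2) @ F --> 1 + \sum_k p0 k ^+ 2.
  apply: cvgD; first exact: cvg_cst.
  by apply: sum_cvg => k; exact: (cvgM (cp k) (cp k)).
have cS : (fun t => 0 + \sum_k (p k t * H k j t + p k t * H k j t)) @ F -->
    0 + \sum_k (p0 k * H0 k j + p0 k * H0 k j).
  apply: cvgD; first exact: cvg_cst.
  by apply: sum_cvg => k; exact: (cvgD (cvgM (cp k) (cH k j)) (cvgM (cp k) (cH k j))).
have c1 := continuous_cvg FF (invsqrt_cvg (one_grad_gt0 p0)) cs.
have c2 := continuous_cvg FF (invsqrt'_cvg (one_grad_gt0 p0)) cs.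
apply: cvgD; last exact: (cvgM c1 (cH i j)).
exact: (cvgM (cp i) (cvgM c2 cS)).
Qed.

(** The formula [flux_deriv], including its term [0 +], is literally what the product and chain
    rules yield. *)
Lemma has_grad_flux A h i : C2_on A h ->
  has_grad A (fun y => pd i h y / Num.sqrt (1 + grad_sq h y))
    (fun j y => flux_deriv (fun k => pd k h y) (fun k l => pd l (pd k h) y) i j).
Proof.
move=> [_ C2]; have gk k := C1_has_grad (C2 k).
have gs := has_gradD (@has_grad_cst R n A 1)
  (has_grad_sum (index_enum 'I_n) (fun k => has_gradM (gk k) (gk k))).
have gF := has_grad_comp (F := fun s => (Num.sqrt s)^-1)
  (F' := fun s => - (Num.sqrt s) ^- 2 * (2 * Num.sqrt s)^-1) gs.
apply: (has_gradM (gk i) (gF _)) => x _; split.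
  apply: is_derive_invsqrt; exact: one_grad_gt0.
apply: invsqrt'_cvg; exact: one_grad_gt0.
Qed.

Lemma H1E A h y : C2_on A h -> A y ->
  H1 h y = \sum_i flux_deriv (fun k => pd k h y) (fun k l => pd l (pd k h) y) i i.
Proof.
by move=> C2 Ay; apply: eq_bigr => i _; rewrite (has_grad_pd i (has_grad_flux i C2) Ay).
Qed.

Lemma flux_derivE (p q : 'I_n -> R) (H G : 'I_n -> 'I_n -> R) i j :
  (forall k, p k = q k) -> (forall k l, H k l = G k l) ->
  flux_deriv p H i j = flux_deriv q G i j.
Proof.
move=> pq HG; have -> : p = q by apply/funext.
by have -> : H = G by apply/funext => k; apply/funext.
Qed.

(** * Adding to [u] a paraboloid that vanishes on a sphere around [x0] *)

Section paraboloid.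
Variables (Omega : set V) (u : V -> R) (x0 : V) (e r : R).
Hypotheses (oO : open Omega) (C2u : C2_on Omega u).

Let h y := u y + e * (sqdist x0 y - r).
Let p i (y : V) := pd i u y + e * (2 * (y ord0 i - x0 ord0 i)).
Let H i j y := pd j (pd i u) y + e * (2 * (i == j)%:R).

Let has_grad_h : has_grad Omega h p.
Proof.
have := has_gradD (C1_has_grad C2u.1) (has_gradM (has_grad_cst (A := Omega) e)
  (has_gradD (has_grad_sqdist (A := Omega) x0) (has_grad_cst (- r)))).
by move/has_grad_eq; apply => i y; rewrite mulr0 !addr0.
Qed.

Let pd_h i y : Omega y -> pd i h y = p i y.
Proof. exact: has_grad_pd. Qed.

Let has_grad_pd_h i : has_grad Omega (pd i h) (H i).
Proof.
apply: (@has_grad_near _ _ _ (p i)) => //; last by move=> y Oy; rewrite pd_h.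
have := has_gradD (C1_has_grad (C2u.2 i)) (has_gradM (has_grad_cst (A := Omega) e)
  (has_gradM (has_grad_cst 2) (has_grad_coord (A := Omega) i (x0 ord0 i)))).
by move/has_grad_eq; apply => j y; rewrite !mulr0 !addr0.
Qed.

Lemma C2_add_paraboloid : C2_on Omega h.
Proof.
by split=> [|i]; [exact: has_grad_C1 has_grad_h|exact: has_grad_C1 (has_grad_pd_h i)].
Qed.

Lemma H1_add_paraboloid y : Omega y -> H1 h y =
  \sum_i flux_deriv (fun k => pd k u y + e * (2 * (y ord0 k - x0 ord0 k)))
    (fun k l => pd l (pd k u) y + e * (2 * (k == l)%:R)) i i.
Proof.
move=> Oy; rewrite (H1E C2_add_paraboloid Oy); apply: eq_bigr => i _.
apply: flux_derivE => [k|k l]; first by rewrite pd_h.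
exact: (has_grad_pd l (has_grad_pd_h k) Oy).
Qed.

End paraboloid.

(** The derivatives of [h], continuous on all of [Omega], serve as their own extensions to the
    closure of [w]. *)
Lemma C2_on_closure (Omega w : set V) h : closure w `<=` Omega ->
  C2_on Omega h -> C2_closure w h.
Proof.
move=> wO C2h; have wO' : w `<=` Omega by move=> x wx; apply/wO/subset_closure.
have cw (f : V -> R) : (forall x, Omega x -> {for x, continuous f}) ->
    {within closure w, continuous f}.
  by move=> cf; apply: continuous_in_subspaceT => x; rewrite inE => /wO; exact: cf.
have C1sub (f : V -> R) : C1_on Omega f -> C1_on w f.
  move=> [cf df]; split; first by move=> x /wO'; exact: cf.
  move=> i; have [d c] := df i.
  by split=> x /wO'; [exact: d|exact: c].
split; first by split=> [|i]; apply: C1sub; [exact: C2h.1|exact: C2h.2].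
split; first by apply: cw; exact: C2h.1.1.
split=> i; first by exists (pd i h); split=> //; apply: cw; exact: (C2h.2 i).1.
move=> j; exists (pd j (pd i h)); split=> //; apply: cw.
by have [] := (C2h.2 i).2 j.
Qed.

(* If [H1 u x0 < 0], a small upward paraboloid added to [u] and vanishing on a
   sphere around [x0] is still [H1]-superharmonic but dips below [u] at [x0]. *)
Lemma H1_subharmonic_ge0 (Omega : set V) u x0 : open Omega -> C2_on Omega u ->
  H1_subharmonic Omega u -> Omega x0 -> 0 <= H1 u x0.
Proof.
move=> oO C2u [_ sub] Ox0; rewrite leNgt; apply/negP => Hneg.
(* [Phi (e, y)] is the value at [y] of [H1] for [u] plus the paraboloid with coefficient [e]. Its
   continuity at [(0, x0)] keeps it negative for small [e] and [y] near [x0]. *)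
pose Phi (t : R * V) := \sum_i flux_deriv
  (fun k => pd k u t.2 + t.1 * (2 * (t.2 ord0 k - x0 ord0 k)))
  (fun k l => pd l (pd k u) t.2 + t.1 * (2 * (k == l)%:R)) i i.
have Phi0 : Phi (0, x0) = H1 u x0.
  rewrite (H1E C2u Ox0); apply: eq_bigr => i _.
  by apply: flux_derivE => [k|k l]; rewrite /= mul0r addr0.
pose F := nbhs ((0, x0) : R * V).
have c1 : (fun t : R * V => t.1) @ F --> (0 : R) by exact: cvg_fst.
have c2 : (fun t : R * V => t.2) @ F --> x0 by exact: cvg_snd.
have cp k : (fun t : R * V => pd k u t.2 + t.1 * (2 * (t.2 ord0 k - x0 ord0 k))) @ F -->
    pd k u x0 + 0 * (2 * (x0 ord0 k - x0 ord0 k)).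
  have ck := C2u.1.2 k; have {}ck := ck.2 _ Ox0.
  apply: cvgD; first exact: (continuous_cvg _ ck c2).
  apply: cvgM => //; apply: cvgM; first exact: cvg_cst.
  apply: cvgB; last exact: cvg_cst.
  exact: (continuous_cvg _ (@coord_continuous R 1 n ord0 k x0) c2).
have cH k l : (fun t : R * V => pd l (pd k u) t.2 + t.1 * (2 * (k == l)%:R)) @ F -->
    pd l (pd k u) x0 + 0 * (2 * (k == l)%:R).
  have ckl := (C2u.2 k).2 l; have {}ckl := ckl.2 _ Ox0.
  apply: cvgD; first exact: (continuous_cvg _ ckl c2).
  by apply: cvgM => //; exact: cvg_cst.
have cPhi : {for (0 : R, x0), continuous Phi}.
  by apply: (@sum_cvg R (R * V)%type F) => i; exact: flux_deriv_cvg.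
have [[A B] [/= A0 Bx0] AB] : \forall t \near (0 : R, x0), Phi t < 0.
  by apply: (cvgr_lt _ cPhi); rewrite Phi0.
have [e e0 Ae] : exists2 e, 0 < e & A e.
  have /nbhs_ballP[d /= d0 dA] := A0; exists (d / 2); first by rewrite divr_gt0.
  by apply: dA; rewrite /ball/= sub0r normrN gtr0_norm ?divr_gt0//; lra.
have [r r0 rP] : exists2 r, 0 < r & forall y, sqdist x0 y <= r -> (Omega `&` B) y.
  by apply: nbhs_sqdist; apply: filterI => //; exact: open_nbhs_nbhs.
pose w := [set y | sqdist x0 y < r].
have ow : open w.
  by have /continuousP/(_ _ (@open_lt R r)) := @sqdist_continuous R n x0.
have cw : closure w `<=` [set y | sqdist x0 y <= r].
  have /continuous_closedP/(_ _ (@closed_le R r)) := @sqdist_continuous R n x0.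
  move=> /closure_id cE y wy; rewrite -[_ y]/((sqdist x0 @^-1` [set x | x <= r]) y) cE.
  by move: wy; apply: closure_subset => z; exact: ltW.
have wO : closure w `<=` Omega by move=> y /cw /rP[].
have main := sub w (fun y => u y + e * (sqdist x0 y - r)) ow wO
  (C2_on_closure wO (C2_add_paraboloid _ _ _ oO C2u)).
have Hw y : w y -> H1 (fun y => u y + e * (sqdist x0 y - r)) y <= 0.
  move=> wy; have [Oy By] := rP y (ltW wy).
  by rewrite (H1_add_paraboloid _ _ _ oO C2u)// ltW//; exact: (AB (e, y)).
have hb y : (closure w `\` w) y -> u y <= u y + e * (sqdist x0 y - r).
  move=> [_ /negP]; rewrite -leNgt => ry.
  by rewrite lerDl mulr_ge0 ?subr_ge0// ltW.
(* At the centre the comparison reads [u x0 <= u x0 - e * r], which is absurd. *)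
have := main Hw hb x0; rewrite /w/= sqdistxx => /(_ r0) => h0.
by have := mulr_gt0 e0 r0; lra.
Qed.

End Subharmonic.

(** * Cutoff functions *)

Section Cutoff.
Variables (R : realType) (n : nat).
Notation V := 'rV[R]_n.

(** The square of the positive part: C^1, with derivative twice the positive part, that is
    [s + |s|]. *)
Definition sqpos (s : R) : R := ((s + `|s|) / 2) ^+ 2.

Lemma sqpos_ge0 s : 0 <= sqpos s.
Proof. exact: sqr_ge0. Qed.

Lemma sqpos_eq0 s : s <= 0 -> sqpos s = 0.
Proof. by move=> s0; rewrite /sqpos ler0_norm// subrr mul0r expr0n. Qed.

Lemma sqpos_le a s : 0 <= a -> a <= s -> a ^+ 2 <= sqpos s.
Proof.
move=> a0 as_; rewrite /sqpos ger0_norm ?(le_trans a0)//.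
by rewrite (_ : (s + s) / 2 = s) ?lerXn2r ?nnegrE ?(le_trans a0)//; field.
Qed.

(** The first-order Taylor remainder is at most [h ^+ 2] in absolute value, whatever the signs of
    [s] and [h + s]. *)
Lemma is_derive_sqpos (s : R) : is_derive s (1 : R) sqpos (s + `|s|).
Proof.
have H : (fun h : R => h^-1 *: ((sqpos \o shift s) (h *: 1) - sqpos s)) @ 0^' --> s + `|s|.
  apply/cvgrPdist_le => e e0; near=> h.
  have h0 : h != 0 by near: h; exact: nbhs_dnbhs_neq.
  have he : `|h| < e.
    near: h; apply: nbhs_dnbhs; apply/nbhs_ballP; exists e => // z.
    by rewrite /ball/= sub0r normrN.
  rewrite /= [h *: 1]mulr1.
  have -> : s + `|s| - h^-1 *: (sqpos (h + s) - sqpos s) =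
      h^-1 * (h * (s + `|s|) - (sqpos (h + s) - sqpos s)).
    by rewrite mulrBr mulKf.
  rewrite normrM normfV ler_pdivrMl ?normr_gt0// (@le_trans _ _ (`|h| ^+ 2))//.
    rewrite real_normK ?num_real// /sqpos ler_norml.
    by case: (ger0P s); case: (ger0P (h + s)) => ? ?; apply/andP; split; nra.
  by rewrite expr2 ler_wpM2l// ltW.
split; first by apply/cvg_ex; exists (s + `|s|).
exact: cvg_lim H.
Unshelve. all: by end_near. Qed.

(** Vanishing in a neighbourhood of each point outside [A] is what permits extension by zero of
    products with functions regular only on [A]. No upper bound is imposed, so that sums of cutoffs
    are cutoffs. *)
Record cutoff (A : set V) (phi : V -> R) : Prop := Cutoff {
  cutoff_C1 : C1_on setT phi;
  cutoff_ge0 : forall x, 0 <= phi x;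
  cutoff_near0 : forall x, ~ A x -> \forall y \near x, phi y = 0;
  cutoff_box : exists2 M : R, 0 < M &
    forall x : V, (exists k, M <= `|x ord0 k|) -> phi x = 0 }.

Lemma cutoff0 A : cutoff A (fun=> 0).
Proof.
split=> //; last by exists 1.
  exact: (has_grad_C1 openT (has_grad_cst (A := setT) 0)).
by move=> x _; apply/nbhs_ballP; exists 1 => //=.
Qed.

Lemma cutoffD A phi psi : cutoff A phi -> cutoff A psi -> cutoff A (fun x => phi x + psi x).
Proof.
move=> [C1p p0 pn [M M0 pM]] [C1q q0 qn [N N0 qN]]; split.
- exact: (has_grad_C1 openT (has_gradD (C1_has_grad C1p) (C1_has_grad C1q))).
- by move=> x; rewrite addr_ge0.
- by move=> x Ax; apply: filterS2 (pn x Ax) (qn x Ax) => y -> ->; rewrite addr0.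
- exists (M + N); first exact: addr_gt0.
  move=> x [k xk]; rewrite pM ?qN ?addr0//; exists k; apply: le_trans xk.
    by rewrite lerDr ltW.
  by rewrite lerDl ltW.
Qed.

Lemma cutoff_ball A (c : V) (s : R) : 0 < s -> (forall y, sqdist c y <= s -> A y) ->
  exists2 phi, cutoff A phi & forall y, sqdist c y < s / 2 -> 1 <= phi y.
Proof.
move=> s0 sA; pose phi y := (s / 2) ^- 2 * sqpos (s - sqdist c y).
have s20 : 0 < s / 2 by rewrite divr_gt0.
have phi0 y : s <= sqdist c y -> phi y = 0.
  by move=> sy; rewrite /phi sqpos_eq0 ?mulr0// subr_le0.
exists phi; last first.
  move=> y ys; rewrite /phi ler_pdivlMl ?exprn_gt0// mulr1.
  by apply: sqpos_le; [exact: ltW|lra].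
split.
- have g := has_gradD (has_grad_cst (A := setT) s)
    (has_gradM (has_grad_cst (-1)) (has_grad_sqdist c)).
  have g' := has_grad_comp (F := sqpos) (F' := fun s => s + `|s|) g.
  apply: has_grad_C1; first exact: openT.
  apply: (@has_grad_near _ _ _ _ _ _ openT (has_gradM (has_grad_cst ((s / 2) ^- 2)) (g' _))).
    move=> x _; split; first exact: is_derive_sqpos.
    exact: (cvgD cvg_id (@norm_continuous R R _)).
  by move=> y _; rewrite mulN1r.
- by move=> x; rewrite mulr_ge0 ?sqpos_ge0// invr_ge0 sqr_ge0.
- move=> x Ax; have sx : s < sqdist c x by rewrite ltNge; apply/negP => /sA.
  have : nbhs x [set y | s < sqdist c y].
    exact: (cvgr_gt _ (@sqdist_continuous R n c x)).
  by apply: filterS => y /ltW /phi0.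
(* A coordinate of this size differs from that of [c] by at least [s + 1], and the square of [s + 1]
   exceeds [s]. *)
- exists (\sum_j `|c ord0 j| + s + 1).
    by rewrite ltr_wpDl// addr_ge0 ?sumr_ge0// ltW.
  move=> x [k xk]; apply: phi0; apply: le_trans (sqdist_ge c x k).
  have ck : `|c ord0 k| <= \sum_j `|c ord0 j|.
    by rewrite (bigD1 k)//= lerDl sumr_ge0.
  have := lerB_dist (x ord0 k) (c ord0 k).
  rewrite -(@real_normK _ (_ - _)) ?num_real//; set d := `|_ - _| => dk.
  by have : s + 1 <= d by [lra]; nra.
Qed.

(** Each point of [K] is the centre of a ball inside [A], and finitely many concentric smaller balls
    cover [K]. The sum of the corresponding ball cutoffs is at least 1 on [K], since every summand
    is non-negative. *)
Lemma exists_cutoff (A K : set V) : open A -> compact K -> K `<=` A ->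
  exists2 phi, cutoff A phi & forall x, K x -> 1 <= phi x.
Proof.
move=> oA cK KA; pose D := [set p : V * R | 0 < p.2 /\ forall y, sqdist p.1 y <= p.2 -> A y].
pose f (p : V * R) := [set y | sqdist p.1 y < p.2 / 2].
have fo p : D p -> open (f p).
  by have /continuousP/(_ _ (@open_lt R (p.2 / 2))) := @sqdist_continuous R n p.1.
have Kf : K `<=` cover D f.
  move=> x Kx; have [s s0 sA] : exists2 s, 0 < s & forall y, sqdist x y <= s -> A y.
    by apply: nbhs_sqdist; apply: open_nbhs_nbhs; split=> //; exact: KA.
  by exists (x, s) => //; rewrite /f/= sqdistxx divr_gt0.
move: cK; rewrite compact_cover => /(_ _ D f fo Kf) [D' D'D KD'].
suff [phi cphi phi1] : exists2 phi, cutoff A phi &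
    forall p, p \in finmap.enum_fset D' -> forall x, f p x -> 1 <= phi x.
  by exists phi => // x /KD' [p pD' fpx]; exact: (phi1 p).
have : forall p, p \in finmap.enum_fset D' -> D p by move=> p /D'D; rewrite inE.
elim: (finmap.enum_fset D') => [_|p s IH sD]; first by exists (fun=> 0); [exact: cutoff0|].
have [phi cphi phi1] := IH (fun q qs => sD q (mem_behead (s := p :: s) qs)).
have [p0 pA] := sD p (mem_head _ _).
have [psi cpsi psi1] := cutoff_ball p0 pA.
exists (fun x => psi x + phi x); first exact: cutoffD.
move=> q; rewrite inE => /orP[/eqP->|qs] x fx.
  by rewrite ler_wpDr ?psi1//; exact: (cutoff_ge0 cphi).
by rewrite ler_wpDl ?(phi1 q)//; exact: (cutoff_ge0 cpsi).
Qed.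

End Cutoff.

(** * The gradient estimate *)

Section GradientBound.
Variables (R : realType) (n : nat).
Notation V := 'rV[R]_n.
Implicit Types (f g u : V -> R) (A : set V).

Lemma derive_at_min f x v : derivable f x v -> (\forall y \near x, f x <= f y) ->
  'D_v f x = 0.
Proof.
move=> df fmin; set q := fun h : R => h^-1 *: ((f \o shift x) (h *: v) - f x).
have cq : q @ 0^' --> 'D_v f x by exact: df.
have cl : (fun h : R => h *: v + x) @ (0 : R) --> x.
  have c : (fun h : R => h *: v + x) @ (0 : R) --> (0 : R) *: v + x.
    by apply: cvgD; [apply: cvgZl; exact: cvg_id|exact: cvg_cst].
  by rewrite scale0r add0r in c.
(* If the derivative were non-zero, difference quotients at small [h] would share its sign.
   Minimality contradicts this at [h = - d] when the derivative is positive and at [h = d] when it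
   is negative. *)
apply/eqP; apply: contraT; rewrite -normr_gt0 => D0.
have near_q : \forall h \near 0^', `|'D_v f x - q h| < `|'D_v f x|.
  by move/cvgrPdist_lt : cq; exact.
have near_f : \forall h \near (0 : R), f x <= f (h *: v + x) by exact: cl fmin.
have /nbhs_ballP[d1 /= d10 P1] := near_q.
have /nbhs_ballP[d2 /= d20 P2] := near_f.
pose d := Num.min d1 d2 / 2.
have d0 : 0 < d by rewrite divr_gt0// lt_min d10.
have dd1 : d < d1.
  by rewrite /d; have : Num.min d1 d2 <= d1 by [rewrite ge_min lexx]; rewrite /d in d0; lra.
have dd2 : d < d2.
  by rewrite /d; have : Num.min d1 d2 <= d2 by [rewrite ge_min lexx orbT]; rewrite /d in d0; lra.
have key h : `|h| = d -> `|'D_v f x - h^-1 * (f (h *: v + x) - f x)| < `|'D_v f x| /\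
    0 <= f (h *: v + x) - f x.
  move=> hd; split.
    apply: P1; first by rewrite /ball/= sub0r normrN hd.
    by rewrite -normr_gt0 hd.
  by rewrite subr_ge0; apply: P2; rewrite /ball/= sub0r normrN hd.
have [Ds|Dn] := ltP 0 ('D_v f x).
  have [] := key (- d); first by rewrite normrN gtr0_norm.
  move=> lt ge; have : 0 <= d^-1 * (f (- d *: v + x) - f x).
    by rewrite mulr_ge0// invr_ge0 ltW.
  by rewrite invrN mulNr opprK (gtr0_norm Ds) in lt => ?; move: lt; rewrite ltr_norml => /andP[]; lra.
have {}Ds : 'D_v f x < 0 by rewrite lt_neqAle Dn andbT -normr_gt0.
have [] := key d; first by rewrite gtr0_norm.
move=> lt ge; have : 0 <= d^-1 * (f (d *: v + x) - f x).
  by rewrite mulr_ge0// invr_ge0 ltW.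
by move=> ?; move: lt; rewrite (ltr0_norm Ds) ltr_norml => /andP[]; lra.
Qed.

Lemma grad_sq_ge0 f x : 0 <= grad_sq f x.
Proof. by apply: sumr_ge0 => i _; exact: sqr_ge0. Qed.

(** With [p = sqrt g] and [w = sqrt (1 + g)] the claim is [(p - 1) * w <= p ^+ 2]. It follows from
    [w <= p + 1] if [p >= 1]; otherwise the left side is not positive. *)
Lemma sqrt_le_area (g : R) : 0 <= g -> Num.sqrt g <= g / Num.sqrt (1 + g) + 1.
Proof.
move=> g0; have g1 : 0 <= 1 + g by rewrite addr_ge0.
have := sqr_sqrtr g0; have := sqr_sqrtr g1.
have := sqrtr_ge0 g; have w0 : 0 < Num.sqrt (1 + g) by rewrite sqrtr_gt0; lra.
move: w0; set p := Num.sqrt g; set w := Num.sqrt _ => w0 p0 w2 p2.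
have wp : w <= p + 1 by rewrite -(@ler_pXn2r _ 2)// ?nnegrE; [nra|exact: ltW|lra].
have pw : p <= w by rewrite -(@ler_pXn2r _ 2)// ?nnegrE; [nra|exact: ltW].
by rewrite -lerBlDr ler_pdivlMr//; nra.
Qed.

Lemma flux_le1 u x i : `|pd i u x / Num.sqrt (1 + grad_sq u x)| <= 1.
Proof.
have s0 : 0 < 1 + grad_sq u x by exact: one_grad_gt0.
have w0 : 0 < Num.sqrt (1 + grad_sq u x) by rewrite sqrtr_gt0.
rewrite normrM normfV (gtr0_norm w0) ler_pdivrMr// mul1r.
rewrite -(@ler_pXn2r _ 2)// ?nnegrE ?(ltW w0)// real_normK ?num_real//.
rewrite sqr_sqrtr ?(ltW s0)// /grad_sq (bigD1 i)//=.
by rewrite addrCA lerDl addr_ge0// sumr_ge0// => j _; exact: sqr_ge0.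
Qed.

Lemma grad_norm_truncation_le u (Omega : set V) (t : R) x : 0 < t -> open Omega ->
  C1_on Omega u -> Omega x ->
  grad_norm (fun y => Num.max (u y) (- t)) x <=
    expR 1 * (expR (t^-1 * u x) * (grad_sq u x / Num.sqrt (1 + grad_sq u x))) + 1.
Proof.
move=> t0 oO C1u Ox; set ut := fun y => _.
have D0 : 0 <= grad_sq u x / Num.sqrt (1 + grad_sq u x).
  by rewrite divr_ge0 ?sqrtr_ge0 ?grad_sq_ge0.
have rhs0 : 0 <= expR 1 * (expR (t^-1 * u x) * (grad_sq u x / Num.sqrt (1 + grad_sq u x))).
  by apply: mulr_ge0; [|apply: mulr_ge0]; rewrite ?expR_ge0.
(* Where the truncation is not differentiable, [grad_norm] is 0 by convention. *)
rewrite /grad_norm; case: ifPn => [/asboolP dut|_]; last by rewrite addr_ge0.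
have [tu|ut_le] := ltP (- t) (u x).
  have cu : {for x, continuous u} by exact: C1u.1.
  have nu : \near x, ut x = u x.
    have : nbhs x [set y | - t < u y] by exact: (cvgr_gt _ cu).
    by apply: filterS => y /= ty; rewrite /ut max_l// ltW.
  have -> : grad_sq ut x = grad_sq u x.
    apply: eq_bigr => i _; congr (_ ^+ 2); exact: near_eq_derive.
  apply: le_trans (sqrt_le_area (grad_sq_ge0 u x)) _; rewrite lerD2r mulrA -expRD.
  (* As [u x > - t], the exponent [1 + t^-1 * u x] is non-negative, so the exponential factor is at
     least 1. *)
  rewrite ler_peMl// -[leLHS]expR0 ler_expR.
  by rewrite -[X in X + _](@mulVf _ t) ?gt_eqF// -mulrDr mulr_ge0 ?invr_ge0 ?(ltW t0)//; lra.
(* Here [ut x = - t] is the global minimum of the truncation. *)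
have -> : grad_sq ut x = 0.
  rewrite /grad_sq big1// => i _; rewrite /pd derive_at_min ?expr0n//.
    exact: diff_derivable.
  apply: (filterS _ filterT) => y _; rewrite /ut (max_r ut_le).
  by rewrite le_max lexx orbT.
by rewrite sqrtr0 addr_ge0.
Qed.

(** The open set [A] and the interior of the zero set of [f] cover the space, and being C^1 is
    local. *)
Lemma C1_on_extend0 A f df : open A -> has_grad A f df ->
  (forall x, ~ A x -> \forall y \near x, f y = 0) -> C1_on setT f.
Proof.
move=> oA fdf f0; pose B := interior [set y | f y = 0].
have fB : has_grad B f (fun _ _ => 0).
  apply: (@has_grad_near _ _ _ (fun=> 0)); first exact: open_interior.
    exact: has_grad_cst.
  by move=> x /interior_subset /= ->.
have [cA dA] := has_grad_C1 oA fdf.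
have [cB dB] := has_grad_C1 (@open_interior _ _) fB.
have AB x : A x \/ B x by have [|/f0] := pselect (A x); [left|right].
split; first by move=> x _; case: (AB x); [exact: cA|exact: cB].
move=> i; have [dAi cAi] := dA i; have [dBi cBi] := dB i.
split; first by move=> x _; case: (AB x); [exact: dAi|exact: dBi].
by move=> x _; case: (AB x); [exact: cAi|exact: cBi].
Qed.

Lemma pd_near0 f x i : (\forall y \near x, f y = 0) -> pd i f x = 0.
Proof.
move=> f0; rewrite /pd (@near_eq_derive _ _ _ f (cst 0))//; exact: derive_cst.
Qed.

(** * The test field and a lower bound for its divergence *)

Section TestField.
Variables (Omega : set V) (u phi : V -> R) (t : R).
Hypotheses (t0 : 0 < t) (oO : open Omega) (C2u : C2_on Omega u).
Hypothesis cphi : cutoff Omega phi.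

Definition test_field i (x : V) : R :=
  phi x * (expR (t^-1 * u x) * (pd i u x / Num.sqrt (1 + grad_sq u x))).

Let E x := expR (t^-1 * u x).
Let v i x := pd i u x / Num.sqrt (1 + grad_sq u x).

(** Kept in the raw shape given by the product rule; the term [u x * 0] comes from the constant
    factor [t^-1]. *)
Let dtest i j x := phi x * (E x * flux_deriv (fun k => pd k u x) (fun k l => pd l (pd k u) x) i j
  + v i x * (E x * (t^-1 * pd j u x + u x * 0))) + E x * v i x * pd j phi x.

Let has_grad_test i : has_grad Omega (test_field i) (dtest i).
Proof.
have gu := C1_has_grad C2u.1.
have gE : has_grad Omega E (fun j x => E x * (t^-1 * pd j u x + u x * 0)).
  apply: (has_grad_comp (F := expR) (F' := expR) (has_gradM (has_grad_cst t^-1) gu)).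
  by move=> x _; split; [exact: is_derive_expR|exact: continuous_expR].
have gphi := has_grad_sub (@subsetT _ Omega) (C1_has_grad (cutoff_C1 cphi)).
exact: (has_gradM gphi (has_gradM gE (has_grad_flux i C2u))).
Qed.

(** Outside [Omega] nothing is known of [u], but the factor [phi] vanishes near every such point. *)
Lemma test_field_C1 i : C1_on setT (test_field i).
Proof.
apply: (C1_on_extend0 oO (has_grad_test i)) => x Ox.
by apply: filterS (cutoff_near0 cphi Ox) => y y0; rewrite /test_field y0 mul0r.
Qed.

Lemma div_test_field_ge x : Omega x -> u x <= 0 -> 0 <= H1 u x ->
  phi x * (expR (t^-1 * u x) * (grad_sq u x / Num.sqrt (1 + grad_sq u x))) <=
  t * (\sum_i pd i (test_field i) x + \sum_i `|pd i phi x|).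
Proof.
move=> Ox ux H0.
have E0 : 0 < E x by exact: expR_gt0.
have E1 : E x <= 1.
  by rewrite /E -expR0 ler_expR pmulr_rle0// invr_gt0.
have -> : \sum_i pd i (test_field i) x =
    phi x * (E x * H1 u x) + t^-1 * (phi x * (E x * (grad_sq u x / Num.sqrt (1 + grad_sq u x))))
    + \sum_i E x * v i x * pd i phi x.
  rewrite (H1E C2u Ox) /grad_sq mulr_suml !mulr_sumr -!big_split /=.
  apply: eq_bigr => i _; rewrite (has_grad_pd i (has_grad_test i) Ox) /dtest /v.
  by rewrite /grad_sq; ring.
(* Each cross term is at least [- |pd i phi x|], because [E x <= 1] and [|v i x| <= 1]. *)
have B : 0 <= \sum_i E x * v i x * pd i phi x + \sum_i `|pd i phi x|.
  rewrite -big_split sumr_ge0//= => i _; rewrite -lerBlDl sub0r.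
  apply: le_trans (ler_norm _) _; rewrite normrN normrM ler_piMl//.
  rewrite normrM (gtr0_norm E0) -[leRHS]mulr1 ler_pM ?(ltW E0)//.
  exact: flux_le1.
have P0 : 0 <= phi x * (E x * H1 u x).
  by rewrite !mulr_ge0 ?(ltW E0)//; exact: (cutoff_ge0 cphi).
rewrite -ler_pdivrMl// -/(E x); lra.
Qed.

End TestField.

End GradientBound.

(** * The integral bound, uniform in [u] *)

Unset Implicit Arguments.

Theorem theorem3p1 (R : realType) (n : nat) (Omega : set 'rV[R]_n) (t : R) :
  domain Omega -> 0 < t ->
  forall w : set 'rV[R]_n, open w -> cpt_sub w Omega ->
  exists C : R, 0 < C /\
    forall u : 'rV[R]_n -> R,
      C2_on Omega u ->
      (forall x, Omega x -> u x <= 0) ->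
      H1_subharmonic Omega u ->
      (iint (fun x => (\1_w x * grad_norm (fun y => Num.max (u y) (- t)) x)%:E)
        <= C%:E)%E.
Proof.
move=> [oO _] t0 w _ [cw wO].
have [phi cphi phi1] := exists_cutoff oO cw wO.
have [M M0 phiM] := cutoff_box cphi.
have [cphi0 dphi] := cutoff_C1 cphi.
(* [Q] is built from [t] and [phi] only, and [phi] was chosen from [w] and [Omega] before [u]; hence
   the uniformity of the constant. *)
pose Q x := expR 1 * t * (\sum_i `|pd i phi x|) + phi x.
have cP : continuous (fun x => \sum_(i < n) `|pd i phi x|).
  move=> x; apply: (@sum_cvg R 'rV[R]_n (nbhs x)) => i; apply: cvg_norm.
  by have [_ +] := dphi i; exact.
have cQ : continuous Q.
  by move=> x; exact: (cvgD (cvgM (cvg_cst (expR 1 * t)) (cP x)) (cphi0 x I)).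
exists (`|boxint M Q| + 1); split; first by rewrite ltr_wpDl.
move=> u C2u u0 subu.
have C1g i := test_field_C1 t oO C2u cphi i.
set g := (test_field u phi t) in C1g.
have cg i : continuous (pd i (g i)).
  by move=> x; have [_ /(_ i)[_ +]] := C1g i; exact.
have [cS intS] := boxint_sum (index_enum 'I_n) (ltW M0) cg.
(* A continuous, compactly supported majorant of the integrand, equal to [Q] plus a multiple of the
   divergence of the test field. *)
pose G x := expR 1 * t * (\sum_i pd i (g i) x) + Q x.
have cG : continuous G.
  by move=> x; exact: (cvgD (cvgM (cvg_cst (expR 1 * t)) (cS x)) (cQ x)).
have f0 (x : 'rV[R]_n) : 0 <= \1_w x * grad_norm (fun y => Num.max (u y) (- t)) x.
  by rewrite mulr_ge0// /grad_norm; case: ifPn => // _; exact: sqrtr_ge0.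
have fG x : \1_w x * grad_norm (fun y => Num.max (u y) (- t)) x <= G x.
  have e1 : 0 < expR 1 :> R by exact: expR_gt0.
  (* Off [Omega] the indicator is 0 and the divergence of the field vanishes, leaving the
     non-negative [Q]. *)
  have [Ox|Ox] := pselect (Omega x); last first.
    rewrite indicE memNset ?mul0r; last by move=> /subset_closure /wO.
    rewrite /G big1 => [|i _].
      rewrite mulr0 add0r addr_ge0 ?(cutoff_ge0 cphi)//.
      by apply: mulr_ge0; [rewrite mulr_ge0 ?ltW|exact: sumr_ge0].
    apply: pd_near0; apply: filterS (cutoff_near0 cphi Ox) => y y0.
    by rewrite /g /test_field y0 mul0r.
  have := div_test_field_ge t0 C2u cphi Ox (u0 x Ox) (H1_subharmonic_ge0 oO C2u subu Ox).
  have := grad_norm_truncation_le t0 oO C2u.1 Ox.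
  set D := expR (t^-1 * u x) * _; set N := grad_norm _ x; set S := \sum_i _; set P := \sum_i _.
  have D0 : 0 <= D.
    by rewrite !mulr_ge0 ?expR_ge0 ?grad_sq_ge0// invr_ge0 sqrtr_ge0.
  have p0 : 0 <= phi x by exact: (cutoff_ge0 cphi).
  move=> ND DS; have -> : G x = expR 1 * (t * (S + P)) + phi x by rewrite /G /Q -/S -/P; ring.
  (* The gradient bound is weighted by [phi], which is at least 1 on [w]; the additive 1 becomes the
     term [phi] of [Q]. *)
  have GD : phi x * (expR 1 * D + 1) <= expR 1 * (t * (S + P)) + phi x.
    by rewrite mulrDr mulr1 lerD2r mulrCA ler_pM2l.
  apply: le_trans GD.
  have eD : 0 <= expR 1 * D by rewrite mulr_ge0// ltW.
  rewrite indicE; case: (boolP (x \in w)) => [|_]; last first.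
    by rewrite mul0r mulr_ge0// addr_ge0.
  rewrite inE => /subset_closure /phi1 => px; rewrite mul1r.
  by apply: le_trans ND _; rewrite ler_peMl// addr_ge0.
(* The strict inequality is an open condition, so [phi] vanishes near [x] and the derivatives in [G]
   vanish too. *)
have G0 (x : 'rV[R]_n) : (exists k, M < `|x ord0 k|) -> G x = 0.
  move=> [k xk]; have phi0 : \forall y \near x, phi y = 0.
    have : nbhs x [set y : 'rV[R]_n | M < `|y ord0 k|].
      have cn : {for x, continuous (fun y : 'rV[R]_n => `|y ord0 k|)}.
        exact: (cvg_norm (@coord_continuous _ _ _ ord0 k x)).
      exact: (cvgr_gt _ cn).
    by apply: filterS => y yk; apply: phiM; exists k; exact: ltW.
  rewrite /G /Q (nbhs_singleton phi0) !big1 ?mulr0 ?addr0// => i _.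
    by rewrite pd_near0 ?normr0.
  by apply: pd_near0; apply: filterS phi0 => y y0; rewrite /g /test_field y0 mul0r.
apply: le_trans (_ : (iint (fun x => (G x)%:E) <= _)%E).
  by apply: le_iint => x; rewrite lee_fin.
rewrite (iint_boxint (ltW M0) cG G0) lee_fin /G boxint_lin ?(ltW M0)//.
(* The divergence integrates to zero, so only the integral of [Q] is left and [u] has
   disappeared. *)
rewrite intS big1 ?mulr0 ?add0r => [|i _]; first by rewrite ler_wpDr ?ler_norm.
apply: boxint_pd => // x xk; rewrite /g /test_field phiM ?mul0r//.
Qed.
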